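(* Let $G$ be a finite group admitting a normal series with cyclic quotients, i.e. a finite supersolvable group. Then $G$ is SEP.
   Context: A normal series with cyclic quotients is a chain $G=G_0\supseteq G_1\supseteq\dots\supseteq G_m=\{1\}$ of subgroups, each normal in $G$, with each $G_i/G_{i+1}$ cyclic. Representations are nonzero, finite-dimensional, over $\mathbb{C}$. A finite group $G$ is called SEP if for every pair of noncommuting elements $x,y\in G$ there exists a representation $\rho$ of $G$ such that $\rho(x)$ and $\rho(y)$ do not share a common eigenvector. *)

(* Defs.v *)
(* The field of complex numbers is [R[i]], for a model [R : realType] of the reals. *)
From mathcomp Require Import all_boot all_order all_algebra all_fingroup.
From mathcomp Require Import all_solvable all_character.
From mathcomp Require Import reals complex.

Set Implicit Arguments.
Unset Strict Implicit.
Unset Printing Implicit Defensive.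

Import GroupScope GRing.Theory.
Local Open Scope ring_scope.

(* [H i] is only meaningful for [i <= m]. *)
Definition has_normal_series_cyclic_quotients
    (gT : finGroupType) (G : {group gT}) : Prop :=
  exists (m : nat) (H : nat -> {group gT}),
    [/\ H 0%N = G,
        H m = 1%G,
        forall i, (i < m)%N -> H i.+1 \subset H i,
        forall i, (i <= m)%N -> H i <| G
      & forall i, (i < m)%N -> cyclic (H i / H i.+1)%g].

(* MathComp's [eigenspace] consists of row vectors. Here vectors are columns, so
   that a matrix representation gives the usual left action on C^n. *)
Definition is_eigenvector (F : fieldType) (n : nat) (A : 'M[F]_n) (v : 'cV[F]_n) : Prop :=
  v != 0 /\ exists a : F, A *m v = a *: v.

Definition share_eigenvector (F : fieldType) (n : nat) (A B : 'M[F]_n) : Prop :=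
  exists v : 'cV[F]_n, is_eigenvector A v /\ is_eigenvector B v.

(* The condition [0 < n] matters: the zero representation has no eigenvectors. *)
Definition SEP (R : realType) (gT : finGroupType) (G : {group gT}) : Prop :=
  forall x y : gT, x \in G -> y \in G -> (x * y)%g <> (y * x)%g ->
    exists (n : nat) (rho : mx_representation R[i] G n),
      (0 < n)%N /\ ~ share_eigenvector (rho x) (rho y).

(* Main.v *)
(** Let z be the commutator of x and y. A common eigenvector of rho(x) and
    rho(y) is fixed by rho(z). Choosing i with z in G_i but not in G_{i+1}, the
    image of z generates a nontrivial subgroup of the cyclic normal subgroup
    G_i/G_{i+1} of G/G_{i+1}, which is therefore normal in G/G_{i+1}. The fixed
    space of a normal subgroup is a subrepresentation, and an invariant
    complement to it in the regular representation of G/G_{i+1} contains no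
    nonzero vector fixed by z. *)
Require Import Defs.
From mathcomp Require Import all_boot all_order all_algebra all_fingroup.
From mathcomp Require Import all_solvable all_character.
From mathcomp Require Import reals complex.

Set Implicit Arguments.
Unset Strict Implicit.
Unset Printing Implicit Defensive.

Import GroupScope GRing.Theory.
Local Open Scope ring_scope.

Lemma mulmx_fixed_eq0 (F : fieldType) (n : nat) (A : 'M[F]_n) (v : 'cV[F]_n) :
  row_free (A - 1%:M) -> A *m v = v -> v = 0.
Proof.
rewrite row_free_unit => uA Av.
by apply: (can_inj (mulKmx uA)); rewrite mulmxBl Av mul1mx subrr mulmx0.
Qed.

(** The fixed space [rfix_mx] consists of row vectors, whereas eigenvectors here are columns.
    Invertibility of the square matrix [rG z - 1%:M] carries the absence of fixed vectors from rows
    to columns. *)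
Lemma row_free_sub1_repr (F : fieldType) (gT : finGroupType) (G : {group gT})
    (n : nat) (rG : mx_representation F G n) (z : gT) :
  z \in G -> rfix_mx rG <[z]> = 0 -> row_free (rG z - 1%:M).
Proof.
move=> Gz fix0; rewrite -kermx_eq0 -submx0 -fix0 -rfix_mx_rstabC ?cycle_subG //.
rewrite inE Gz /=; apply/eqP/subr0_eq.
by rewrite -[X in _ - X]mulmx1 -mulmxBr mulmx_ker.
Qed.

Lemma mx_repr_without_fixed_vectors (F : fieldType) (gT : finGroupType)
    (G : {group gT}) (z : gT) :
    [pchar F]^'.-group G -> z \in G -> z != 1%g -> <[z]> <| G ->
  exists (n : nat) (rho : mx_representation F G n),
    (0 < n)%N /\ row_free (rho z - 1%:M).
Proof.
move=> F'G Gz z_neq1 nZ; pose aG := regular_repr F G.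
have sZG := normal_sub nZ.
have [W Wmod defW dxW] :=
  mx_Maschke_pchar aG F'G (normal_rfix_mx_module aG nZ) (submx1 _).
exists (\rank W), (submod_repr Wmod); split.
  (* If [W] were zero, [z] would act trivially, but the regular representation is faithful. *)
  rewrite lt0n mxrank_eq0; apply: contraNneq z_neq1 => W0.
  have faithful_aG := subsetP (regular_mx_faithful F G).
  rewrite -in_set1; apply: faithful_aG; rewrite inE Gz mul1mx.
  have: (1%:M <= rfix_mx aG <[z]>)%MS by rewrite -defW W0 addsmx0.
  by move=> /rfix_mxP aG1; rewrite -[aG z]mul1mx aG1 ?eqxx ?cycle_id.
apply: row_free_sub1_repr => //; apply/eqP; rewrite -submx0 rfix_submod //.
by rewrite capmxC (mxdirect_addsP dxW) linear0 sub0mx.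
Qed.

Lemma share_eigenvector_fixed_commg (F : fieldType) (gT : finGroupType)
    (G : {group gT}) (n : nat) (rG : mx_representation F G n) (x y : gT) :
    x \in G -> y \in G -> share_eigenvector (rG x) (rG y) ->
  exists2 v : 'cV[F]_n, v != 0 & rG [~ x, y] *m v = v.
Proof.
move=> Gx Gy [v [[v0 [a xv]] [_ [b yv]]]]; exists v => //.
have Gyx: (y * x)%g \in G by rewrite groupM.
(* Since [x * y = y * x * [~ x, y]], the invertible [rG (y * x)] sends both sides to
   [(a * b) *: v]. *)
apply: (can_inj (mulKmx (repr_mx_unit rG Gyx))).
rewrite mulmxA -repr_mxM ?groupR // -commgC !repr_mxM // -!mulmxA.
by rewrite xv yv -!scalemxAr xv yv !scalerA mulrC.
Qed.

Lemma nat_switch (P : nat -> bool) (m : nat) :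
  P 0%N -> ~~ P m -> exists i, [/\ (i < m)%N, P i & ~~ P i.+1].
Proof.
move=> P0; elim: m => [|m IHm]; first by rewrite P0.
have [Pm P'm1|P'm _] := boolP (P m); first by exists m.
by have [i [ltim Pi P'i1]] := IHm P'm; exists i; rewrite ltnS ltnW.
Qed.

Theorem theorem1p1p31 (R : realType) (gT : finGroupType) (G : {group gT}) :
  has_normal_series_cyclic_quotients G -> SEP R G.
Proof.
move=> [m [H [H0 Hm _ nH cycH]]] x y Gx Gy xy_neq.
pose z := [~ x, y]; have Gz: z \in G by rewrite groupR.
have z_neq1: z != 1%g by apply/commgP.
have [||i [ltim Hz H'z]] := @nat_switch (fun i => z \in H i) m.
- by rewrite H0.
- by rewrite Hm inE.
have nKG: G \subset 'N(H i.+1) := normal_norm (nH _ ltim).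
have nKz := subsetP nKG z Gz.
have Kz_neq1: coset (H i.+1) z != 1%g by apply: contra H'z => /eqP/coset_idr->.
have nKz_G: <[coset (H i.+1) z]> <| G / H i.+1.
  (* Subgroups of a cyclic group are characteristic. *)
  apply: char_normal_trans (quotient_normal _ (nH i (ltnW ltim))).
  by rewrite sub_cyclic_char ?cycH // cycle_subG mem_quotient.
have F'G: [pchar R[i]]^'.-group (G / H i.+1).
  (* In characteristic zero the group order is invertible, as Maschke's theorem requires. *)
  rewrite /pgroup pcharf'_nat (pcharf0P _).1 ?cardG_gt0 -?lt0n //.
  exact: Num.Theory.pchar_num.
have [n [rho [n_gt0 free_z]]] :=
  mx_repr_without_fixed_vectors F'G (mem_quotient _ Gz) Kz_neq1 nKz_G.
(* [rho] is pulled back to [G] along the quotient map. *)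
exists n, (morphim_repr rho nKG); split=> // /share_eigenvector_fixed_commg.
by case=> // v /eqP v_neq0 /(mulmx_fixed_eq0 free_z).
Qed.
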